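(* Let $M$ be a matroid of finite rank on a set $E$, where $E$ is finite or countably infinite. Then $M$ is embeddable in an OTE matroid of the same rank, i.e. there is an OTE matroid $N$ of rank equal to that of $M$ on a ground set containing $E$ with $N|E=M$.
   Context: A modular cut of a matroid $M$ is a set $\mathcal{M}$ of flats such that (1) any flat containing a member of $\mathcal{M}$ is in $\mathcal{M}$; (2) if $F_1,F_2\in\mathcal{M}$ form a modular pair, i.e. $\operatorname{rk}(F_1)+\operatorname{rk}(F_2)=\operatorname{rk}(F_1\cup F_2)+\operatorname{rk}(F_1\cap F_2)$, then $F_1\cap F_2\in\mathcal{M}$. A modular cut is principal if it equals $\{G: G\text{ a flat}, G\supseteq F\}$ for some flat $F$. A matroid is OTE if every modular cut other than the empty one is principal. *)

(* Defs.v *)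
From mathcomp Require Import all_boot.
From mathcomp Require Import boolp classical_sets functions cardinality.

Set Implicit Arguments.
Unset Strict Implicit.
Unset Printing Implicit Defensive.

Local Open Scope classical_set_scope.
Local Open Scope card_scope.

(* A matroid of finite rank whose ground set is the whole (possibly infinite)
   type E, given by its rank function on all subsets of E.  The first three
   axioms are the usual ones; [rk_finitary] says that the rank of an infinite
   set is the maximum of the ranks of its finite subsets, which is not implied
   by the other axioms (consider: rank 0 on finite sets, 1 on infinite ones). *)
Record matroid (E : Type) := Matroid {
  rk : set E -> nat;
  rk_le_card : forall (A : set E) (n : nat), A #= `I_n -> rk A <= n;
  rk_mono : forall A B : set E, A `<=` B -> rk A <= rk B;
  rk_submod : forall A B : set E,
    rk (A `|` B) + rk (A `&` B) <= rk A + rk B;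
  rk_finitary : forall A : set E,
    exists2 B : set E, finite_set B & B `<=` A /\ rk B = rk A
}.

Definition rank (E : Type) (M : matroid E) : nat := rk M [set: E].

Definition closure (E : Type) (M : matroid E) (A : set E) : set E :=
  [set x | rk M (A `|` [set x]) = rk M A].

Definition flat (E : Type) (M : matroid E) (F : set E) : Prop :=
  closure M F = F.

Definition modular_pair (E : Type) (M : matroid E) (F G : set E) : Prop :=
  rk M F + rk M G = rk M (F `|` G) + rk M (F `&` G).

Definition modular_cut (E : Type) (M : matroid E) (C : set (set E)) : Prop :=
  [/\ forall F, C F -> flat M F,
      forall F G, C F -> flat M G -> F `<=` G -> C G
    & forall F G, C F -> C G -> modular_pair M F G -> C (F `&` G)].

Definition principal (E : Type) (M : matroid E) (C : set (set E)) : Prop :=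
  exists2 F : set E, flat M F & C = [set G | flat M G /\ F `<=` G].

Definition OTE (E : Type) (M : matroid E) : Prop :=
  forall C : set (set E), modular_cut M C -> C <> set0 -> principal M C.

(* Ground sets being types, "the ground set S of N contains E and N|E = M" is
   expressed by an injection f : E -> S, which identifies E with a subset of S
   and under which the rank function of N restricts to that of M. *)
Definition embedding (E S : Type) (M : matroid E) (N : matroid S)
    (f : E -> S) : Prop :=
  injective f /\ forall A : set E, rk N (f @` A) = rk M A.

(* Main.v *)
(* Call a modular cut bad for flats F, G if it contains F and G but not their
   intersection; in finite rank, M is OTE as soon as no pair has a bad cut.  If
   C is bad for F, G, the single-element extension of M defined by C has the
   same rank and adds to the closures of F and G a common element outside the
   closure of their intersection.  Enumerate the pairs of finite sets so that
   each occurs infinitely often, and at stage n extend by a bad cut for the n-th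
   pair, if there is one.  A bad cut of the limit would restrict to bad cuts at
   all late stages; but once a finite set spanning the intersection of the two
   flats in the limit is present, extending again would raise its rank.

   All stages live on nat, where E occupies even numbers and the element added
   at stage n is 2n + 1, a loop until then. *)
Require Import Defs.
From mathcomp Require Import all_boot.
From mathcomp Require Import boolp classical_sets functions cardinality.
From mathcomp Require Import zify.

Set Implicit Arguments.
Unset Strict Implicit.

Local Open Scope classical_set_scope.
Local Open Scope card_scope.

(* [fingraph.closure] shadows the matroid closure. *)
Local Notation closure := Defs.closure.

Lemma finite_set_ind (T : Type) (P : set T -> Prop) :
  P set0 -> (forall x A, P A -> P (A `|` [set x])) ->
  forall A, finite_set A -> P A.
Proof.
move=> P0 PU A [n]; elim: n A => [|n IH] A.
  by rewrite II0 card_eq0 => /eqP ->.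
move=> /eq_cardSP[x Ax /IH /(PU x)]; rewrite setUC setDUK //.
by move=> y ->.
Qed.

(** * Closure, flats and modular pairs *)

Section Closure.
Context {E : Type} (M : matroid E).
Implicit Types A B F G X : set E.

Lemma rk_set0 : rk M set0 = 0.
Proof.
have /rk_le_card : (set0 : set E) #= `I_0 by rewrite II0.
by move=> /(_ M); case: (rk M set0).
Qed.

Lemma rk_set1 x : rk M [set x] <= 1.
Proof.
exact/rk_le_card/card_set1.
Qed.

Lemma rkU1_le A B x : A `<=` B -> rk M (A `|` [set x]) = rk M A ->
  rk M (B `|` [set x]) = rk M B.
Proof.
move=> AB Ax; have := rk_submod M (A `|` [set x]) B.
rewrite -setUA [[set x] `|` B]setUC setUA (setUidr AB).
have : rk M A <= rk M ((A `|` [set x]) `&` B).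
  by apply: rk_mono => y Ay; split; [left | apply: AB].
have : rk M B <= rk M (B `|` [set x]) by apply: rk_mono => y; left.
lia.
Qed.

Lemma closureS A B : A `<=` B -> closure M A `<=` closure M B.
Proof. by move=> AB x; apply: rkU1_le. Qed.

Lemma subset_closure A : A `<=` closure M A.
Proof.
move=> x Ax; rewrite /closure /=; congr (rk M _).
by apply: setUidl => y ->.
Qed.

(** By [rk_finitary] a finite subset of the closure attains its rank, and adding its elements to [A]
    one at a time never raises the rank. *)
Lemma rk_closure A : rk M (closure M A) = rk M A.
Proof.
have [B finB [BA rkB]] := rk_finitary M (closure M A).
apply/eqP; rewrite eqn_leq; apply/andP; split; last first.
  exact/rk_mono/subset_closure.
suff <- : rk M (A `|` B) = rk M A by rewrite -rkB; apply: rk_mono => x; right.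
move: B finB BA {rkB}; apply: finite_set_ind => [_|x B IH sB].
  by rewrite setU0.
have sB' : B `<=` closure M A by move=> y By; apply: sB; left.
rewrite setUA -[RHS](IH sB'); apply: (@rkU1_le A); first by move=> y; left.
by apply: sB; right.
Qed.

Lemma subset_closure_rk A B :
  A `<=` B -> rk M B = rk M A -> B `<=` closure M A.
Proof.
move=> AB rkAB x Bx; apply/eqP; rewrite eqn_leq -{1}rkAB; apply/andP.
by split; apply: rk_mono => y; [case=> [/AB | ->] | left].
Qed.

Lemma eq_closure A B : A `<=` B -> rk M B = rk M A -> closure M B = closure M A.
Proof.
move=> AB rkAB; apply/seteqP; split; last exact: closureS.
apply: subset_closure_rk; first exact/(subset_trans AB)/subset_closure.
by rewrite rk_closure.
Qed.

Lemma flat_closure A : flat M (closure M A).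
Proof. exact: eq_closure (@subset_closure A) (rk_closure _). Qed.

Lemma closure_subset_flat A F : flat M F -> A `<=` F -> closure M A `<=` F.
Proof. by move=> flatF /closureS; rewrite flatF. Qed.

Lemma flatI F G : flat M F -> flat M G -> flat M (F `&` G).
Proof.
move=> flatF flatG; apply/seteqP; split; last exact: subset_closure.
by move=> x FGx; split; [rewrite -flatF | rewrite -flatG];
  apply: closureS FGx => y [].
Qed.

(** Taking closures preserves the ranks of both sets and of their union, so submodularity keeps the
    rank of the intersection from growing. *)
Lemma closure_modular_pair A B : modular_pair M A B ->
  closure M A `&` closure M B = closure M (A `&` B) /\
  modular_pair M (closure M A) (closure M B).
Proof.
rewrite /modular_pair => modAB.
have rkU : rk M (closure M A `|` closure M B) = rk M (A `|` B).
  apply/eqP; rewrite eqn_leq; apply/andP; split.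
    rewrite -(rk_closure (A `|` B)); apply: rk_mono => x.
    by case; apply: closureS => y; [left | right].
  by apply: rk_mono => x [/subset_closure | /subset_closure]; [left | right].
have sI : A `&` B `<=` closure M A `&` closure M B.
  by move=> x [/subset_closure ? /subset_closure ?].
have rkI : rk M (closure M A `&` closure M B) = rk M (A `&` B).
  have := rk_submod M (closure M A) (closure M B).
  have := @rk_mono _ M _ _ sI; rewrite rkU !rk_closure; lia.
split; last by rewrite rkU rkI !rk_closure.
rewrite -(eq_closure sI rkI).
by apply/esym/flatI; apply: flat_closure.
Qed.

(** A member of least rank is the generator: its intersection with any other member is again a
    member, hence of the same rank, hence equal to it. *)
Lemma modular_cut_principal (C : set (set E)) :
  modular_cut M C -> C <> set0 ->
  (forall F G, C F -> C G -> C (F `&` G)) -> principal M C.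
Proof.
move=> [Cflat Cup _] C0 CI.
have [F0 CF0] : exists F, C F.
  apply: contra_notP C0 => H; rewrite predeqE => F; split=> // CF.
  by case: H; exists F.
pose P n := `[< exists2 F, C F & rk M F = n >].
have exP : exists n, P n by exists (rk M F0); apply/asboolP; exists F0.
case: (ex_minnP exP) => m /asboolP[F CF rkF] mmin.
exists F; first exact: Cflat.
rewrite predeqE => G; split=> [CG | [flatG FG]]; last exact: Cup FG.
split; first exact: Cflat.
have flatFG : flat M (F `&` G) by apply: flatI; apply: Cflat.
suff : F `<=` F `&` G by move=> FFG x /FFG[].
rewrite -[X in _ `<=` X]flatFG; apply: subset_closure_rk; first by move=> x [].
apply/eqP; rewrite eqn_leq; apply/andP; split; last by apply: rk_mono => x [].
by rewrite rkF; apply: mmin; apply/asboolP; exists (F `&` G); [apply: CI|].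
Qed.

End Closure.

(** * Single-element extensions by modular cuts *)

Lemma matroid_of_rk (E : Type) (r : set E -> nat) :
  r set0 = 0 -> (forall x, r [set x] <= 1) ->
  (forall A B, A `<=` B -> r A <= r B) ->
  (forall A B, r (A `|` B) + r (A `&` B) <= r A + r B) ->
  (forall A, exists2 B, finite_set B & B `<=` A /\ r B = r A) ->
  exists M : matroid E, rk M = r.
Proof.
move=> r0 r1 rmono rsub rfin.
suff rcard (A : set E) n : A #= `I_n -> r A <= n.
  by exists (Matroid rcard rmono rsub rfin).
elim: n A => [|n IH] A; first by rewrite II0 card_eq0 => /eqP ->; rewrite r0.
move=> /eq_cardSP[x Ax /IH rAx].
have <- : A `\` [set x] `|` [set x] = A by rewrite setUC setDUK // => y ->.
by have := rsub (A `\` [set x]) [set x]; have := r1 x; lia.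
Qed.

Lemma loopU (E : Type) (M : matroid E) e (A : set E) :
  rk M [set e] = 0 -> rk M (A `|` [set e]) = rk M A.
Proof. by move=> e0; apply: (@rkU1_le _ _ set0); rewrite ?set0U ?rk_set0. Qed.

(* Crapo's single-element extension; here the new element is already present as
   a loop [e] of [M], which keeps the ground set fixed. *)
Lemma modular_cut_extension (E : Type) (M : matroid E) (C : set (set E)) e :
  modular_cut M C -> rk M [set e] = 0 ->
  exists M' : matroid E,
    forall A, rk M' A = rk M A + `[< A e /\ ~ C (closure M A) >].
Proof.
move=> [_ Cup Cmod] e0.
have CS A B : A `<=` B -> C (closure M A) -> C (closure M B).
  by move=> AB CA; apply: (Cup _ _ CA (flat_closure _ _)); apply: closureS.
pose r A := rk M A + `[< A e /\ ~ C (closure M A) >].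
have rmono A B : A `<=` B -> r A <= r B.
  move=> AB; rewrite /r; have leAB := rk_mono M AB.
  case: asboolP => [[Ae nCA]|_]; last lia.
  case: asboolP => [_|nB]; first lia.
  (* If the ranks agreed, so would the closures, and [B] would get the increment too. *)
  suff : rk M A != rk M B by lia.
  apply/eqP => rkAB; apply: nB; split; first exact: AB.
  by rewrite (eq_closure AB).
suff [M' rkM'] : exists M' : matroid E, rk M' = r by exists M'; rewrite rkM'.
apply: matroid_of_rk => //.
- by rewrite /r rk_set0; case: asboolP => // -[].
- move=> x; rewrite /r; case: asboolP => [[/= <- _]|_]; first by rewrite e0.
  by rewrite addn0 rk_set1.
- move=> A B; rewrite /r; have subm := rk_submod M A B.
  have CUl := CS _ _ (@subsetUl _ A B); have CUr := CS _ _ (@subsetUr _ A B).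
  have CI : C (closure M A) -> C (closure M B) ->
      rk M (A `|` B) + rk M (A `&` B) = rk M A + rk M B ->
      C (closure M (A `&` B)).
    move=> CA CB /esym/closure_modular_pair[<-]; exact: Cmod.
  (* The increments of the union, the intersection, [A] and [B]. If the intersection gets one but
     neither [A] nor [B] does, both closures lie in [C], so the pair is not modular and strict
     submodularity pays for it. *)
  set u := `[< _ >]; set i := `[< _ >]; set a := `[< _ >]; set b := `[< _ >].
  have ui_ab : u -> i -> a && b.
    move=> /asboolP[_ nCU] /asboolP[[Ae Be] _].
    apply/andP; split; apply/asboolP; split=> // ?; apply: nCU.
      exact: CUl.
    exact: CUr.
  have u_ab : u -> a || b.
    move=> /asboolP[[Ue|Ue] nCU]; apply/orP; [left|right]; apply/asboolP;
      split=> // ?; apply: nCU; first exact: CUl.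
    exact: CUr.
  have i_ab : i -> ~~ a -> ~~ b ->
      rk M (A `|` B) + rk M (A `&` B) != rk M A + rk M B.
    move=> /asboolP[[Ae Be] nCI] /asboolP na /asboolP nb.
    apply/eqP => /CI h; apply: nCI; apply: h; apply: contrapT => ?.
      by apply: na.
    by apply: nb.
  by move: ui_ab u_ab i_ab; case: u; case: i; case: a; case: b => //=; lia.
- move=> A; have [B finB [BA rkB]] := rk_finitary M A.
  have [Ae|nAe] := pselect (A e).
    (* The loop [e] joins [B] at no cost in rank, so that [B] receives the same increment as [A]. *)
    exists (B `|` [set e]); first by rewrite finite_setU; split.
    have BeA : B `|` [set e] `<=` A by move=> x [/BA | ->].
    have rkBe : rk M (B `|` [set e]) = rk M A by rewrite loopU.
    split=> //; rewrite /r rkBe (eq_closure BeA) //.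
    congr (_ + nat_of_bool _); apply: asbool_equiv_eq.
    by split=> -[_ ?]; split=> //; right.
  exists B => //; split=> //; rewrite /r rkB.
  by case: asboolP => [[/BA]|_] //; case: asboolP => [[]|].
Qed.

(** A bad cut for the closures of [A] and [B]. Indexing by arbitrary sets lets one pair be followed
    through all stages while closures change. *)
Definition splitting (E : Type) (M : matroid E) (A B : set E)
    (C : set (set E)) : Prop :=
  [/\ modular_cut M C, C (closure M A), C (closure M B)
    & ~ C (closure M A `&` closure M B)].

(** The conclusions under [splitting] do not mention [C]: [M'] need only come from one bad cut, and
    [M] resolves itself when there is none. *)
Definition resolves (E : Type) (M : matroid E) (A B : set E) (e : E)
    (M' : matroid E) : Prop :=
  [/\ forall X, rk M X <= rk M' X,
      forall X, ~ X e -> rk M' X = rk M X,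
      rank M' = rank M
    & forall C, splitting M A B C ->
      [/\ rk M' (A `|` [set e]) = rk M' A, rk M' (B `|` [set e]) = rk M' B
        & forall D, D `<=` closure M A `&` closure M B ->
            rk M' (D `|` [set e]) = (rk M D).+1]].

(** The hypothesis on [e] stands under the quantifier on [M'] so that [choice] yields a total step
    function, with [M] as default value. *)
Lemma resolvesP (E : Type) (M : matroid E) (A B : set E) e :
  exists M', rk M [set e] = 0 -> resolves M A B e M'.
Proof.
have [e0|] := pselect (rk M [set e] = 0); last by exists M.
have [[C [cutC CA CB nCAB]] | nC] := pselect (exists C, splitting M A B C);
  last first.
  by exists M => _; split=> // C CP; case: nC; exists C.
have [M' rkM'] := modular_cut_extension cutC e0; exists M' => _.
have [_ Cup _] := cutC.
have cle X : closure M (X `|` [set e]) = closure M X.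
  by apply: eq_closure; [left | rewrite loopU].
have rkX X : C (closure M X) -> rk M' X = rk M X.
  by move=> CX; rewrite rkM'; case: asboolP => [[]|]; rewrite ?addn0.
split.
- by move=> X; rewrite rkM' leq_addr.
- by move=> X nXe; rewrite rkM'; case: asboolP => [[]|]; rewrite ?addn0.
- apply: rkX; apply: (Cup _ _ CA (flat_closure _ _)); exact: closureS.
- move=> _ _; split.
  + by rewrite !rkX ?cle ?loopU.
  + by rewrite !rkX ?cle ?loopU.
  + move=> D DAB; rewrite rkM' cle loopU //.
    case: asboolP => [_|]; first by rewrite addn1.
    case; split; first by right.
    (* Upward closure would put the intersection of the two closures, a flat containing [D], into
       [C]. *)
    move=> CD; apply: nCAB.
    have flatAB : flat M (closure M A `&` closure M B).
      by apply: flatI; apply: flat_closure.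
    by apply: (Cup _ _ CD flatAB); apply: closure_subset_flat.
Qed.

(** * Limits of increasing sequences of matroids *)

(** The rank of each set is nondecreasing along the sequence and bounded by the common rank, so it
    stabilizes; the axioms are read off at late stages. *)
Lemma limit_matroid (E : Type) (N : nat -> matroid E) :
  (forall n A, rk (N n) A <= rk (N n.+1) A) ->
  (forall n, rank (N n) = rank (N 0)) ->
  exists L : matroid E,
    forall A, exists n, forall m, n <= m -> rk (N m) A = rk L A.
Proof.
move=> Nmono Nrank.
have Nle A : {homo (fun n => rk (N n) A) : m n / m <= n}.
  by apply: homo_leq => // ? ? ?; apply: leq_trans.
have Nbnd n A : rk (N n) A <= rank (N 0).
  by rewrite -(Nrank n); apply: rk_mono.
have stab A : exists v n, forall m, n <= m -> rk (N m) A = v.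
  pose P v := `[< exists n, rk (N n) A = v >].
  have exP : exists v, P v by exists (rk (N 0) A); apply/asboolP; exists 0.
  have ubP v : P v -> v <= rank (N 0) by move=> /asboolP[n <-].
  case: (ex_maxnP exP ubP) => v /asboolP[n rkn] vmax.
  exists v, n => m nm; apply/eqP; rewrite eqn_leq -{2}rkn Nle // andbT.
  by apply: vmax; apply/asboolP; exists m.
have [r rP] := choice stab.
suff [L rkL] : exists L : matroid E, rk L = r by exists L; rewrite rkL.
apply: matroid_of_rk.
- by have [n /(_ _ (leqnn n))] := rP set0; rewrite rk_set0.
- by move=> x; have [n /(_ _ (leqnn n)) <-] := rP [set x]; apply: rk_set1.
- move=> A B AB; have [[n rA] [m rB]] := (rP A, rP B).
  rewrite -(rA _ (leq_maxl n m)) -(rB _ (leq_maxr n m)); exact: rk_mono.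
- move=> A B; have [[n rA] [m rB]] := (rP A, rP B).
  have [[n' rU] [m' rI]] := (rP (A `|` B), rP (A `&` B)).
  pose k := n + m + n' + m'.
  by rewrite -(rA k) -?(rB k) -?(rU k) -?(rI k) ?rk_submod // /k; lia.
- move=> A; have [n rA] := rP A.
  (* At stage [n] the rank of [A] is final and [B] attains it; later the rank of [B] can neither
     drop nor exceed it. *)
  have [B finB [BA rkB]] := rk_finitary (N n) A.
  exists B => //; split=> //; have [m rB] := rP B.
  rewrite -(rA _ (leq_maxl n m)) -(rB _ (leq_maxr n m)).
  apply/eqP; rewrite eqn_leq rk_mono //= (rA _ (leq_maxl _ _)).
  by rewrite -(rA n) // -rkB Nle // leq_maxl.
Qed.

(** Lets a cut of the limit be read at a stage, with [S] the elements present there. A set has the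
    same rank in [M] as its trace on [S] has in [L], so modular pairs go to modular pairs. *)
Lemma modular_cut_restriction (E : Type) (M L : matroid E) (S : set E)
    (C : set (set E)) :
  (forall A, A `<=` S -> rk L A = rk M A) ->
  (forall A, rk M (A `&` S) = rk M A) ->
  modular_cut L C ->
  modular_cut M [set F | flat M F /\ C (closure L (F `&` S))].
Proof.
move=> LM MS [Cflat Cup Cmod]; split.
- by move=> F [].
- move=> F G [_ CF] flatG FG; split=> //.
  by apply: (Cup _ _ CF (flat_closure _ _)); apply: closureS; apply: setSI.
- move=> F G [flatF CF] [flatG CG] modFG; split; first exact: flatI.
  have rkL X : rk L (X `&` S) = rk M X.
    by rewrite -[RHS]MS; apply: LM => x [].
  have modS : modular_pair L (F `&` S) (G `&` S).
    by rewrite /modular_pair -setIUl -setIIl !rkL.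
  have [clI modcl] := closure_modular_pair modS.
  by rewrite setIIl -clI; apply: Cmod.
Qed.

(** * The tower of extensions and its limit *)

Section Tower.
Context {T : Type} {N : nat -> matroid T} {e : nat -> T} {L : matroid T}.
Context {p : nat -> set T * set T}.

Hypothesis loop_e : forall n m, n <= m -> rk (N n) [set e m] = 0.
Hypothesis resN : forall n, resolves (N n) (p n).1 (p n).2 (e n) (N n.+1).
Hypothesis limL : forall A, exists n, forall m, n <= m -> rk (N m) A = rk L A.
Hypothesis late_e : forall A, finite_set A ->
  exists n, forall m, n <= m -> ~ A (e m).
Hypothesis often_p : forall A B n, finite_set A -> finite_set B ->
  exists2 m, n <= m & p m = (A, B).

(** The elements present at stage [n]; all others are still loops of [N n]. *)
Let S n : set T := [set x | forall m, n <= m -> x <> e m].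

(** Steps from [n] on change only the ranks of sets that contain the element being added, and [A]
    contains none of these. *)
Lemma rk_stage n A : A `<=` S n -> rk L A = rk (N n) A.
Proof.
move=> AS; have [k rA] := limL A.
rewrite -(rA (n + k)) ?leq_addl // => {rA}.
elim: k => [|k <-]; rewrite ?addn0 // addnS.
have [_ + _ _] := resN (n + k); apply=> /AS /(_ (n + k)).
by rewrite leq_addr => /(_ isT).
Qed.

Lemma rk_stageI n A : rk (N n) (A `&` S n) = rk (N n) A.
Proof.
apply/eqP; rewrite eqn_leq; apply/andP; split; first by apply: rk_mono => x [].
rewrite -[X in _ <= X]rk_closure; apply: rk_mono => x Ax.
have [Sx|nSx] := pselect (S n x); first exact: subset_closure.
have [m nm xm] : exists2 m, n <= m & x = e m.
  by apply: contra_notP nSx => H m nm xm; apply: H; exists m.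
by rewrite xm; apply: loopU; apply: loop_e.
Qed.

Lemma stageS m n : m <= n -> S m `<=` S n.
Proof. by move=> mn x Sx k /(leq_trans mn) /Sx. Qed.

Lemma finite_stage A : finite_set A -> exists n, A `<=` S n.
Proof.
move=> /late_e[n H]; exists n => x Ax m nm xm.
by apply: (H m nm); rewrite -xm.
Qed.

Lemma tower_OTE : OTE L.
Proof.
move=> C cutC C0; apply: modular_cut_principal => // F G CF CG.
have [Cflat Cup _] := cutC.
apply: contrapT => nCFG.
have [A finA [AF rkA]] := rk_finitary L F.
have [B finB [BG rkB]] := rk_finitary L G.
have [D finD [DFG rkD]] := rk_finitary L (F `&` G).
have clA : closure L A = F.
  by rewrite -[RHS](Cflat _ CF); apply/esym/eq_closure.
have clB : closure L B = G.
  by rewrite -[RHS](Cflat _ CG); apply/esym/eq_closure.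
have [n0 ABDS] : exists n, A `|` B `|` D `<=` S n.
  by apply: finite_stage; rewrite !finite_setU; do !split.
(* The pair [(A, B)] comes up at a stage where [A], [B] and [D] are all present. *)
have [n n0n pn] := often_p n0 finA finB.
have {}ABDS := subset_trans ABDS (stageS n0n).
have AS : A `<=` S n by move=> x ?; apply: ABDS; left; left.
have BS : B `<=` S n by move=> x ?; apply: ABDS; left; right.
have DS : D `<=` S n by move=> x ?; apply: ABDS; right.
have LN X : X `<=` S n -> rk L X = rk (N n) X by exact: rk_stage.
have cutCn := modular_cut_restriction LN (rk_stageI n) cutC.
have clS X : X `<=` S n ->
    closure L (closure (N n) X `&` S n) = closure L X.
  move=> XS; apply: eq_closure => [x Xx|].
    by split; [exact: subset_closure | exact: XS].
  rewrite LN; last by move=> x [].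
  by rewrite rk_stageI rk_closure LN.
set Cn := [set F | _ /\ _] in cutCn.
have split_n : splitting (N n) A B Cn.
  split=> //.
  - by split; [exact: flat_closure | rewrite clS // clA].
  - by split; [exact: flat_closure | rewrite clS // clB].
  - move=> [_ CAB]; apply: nCFG.
    have flatFG := flatI (Cflat _ CF) (Cflat _ CG).
    apply: (Cup _ _ CAB flatFG); apply: closure_subset_flat => //.
    move=> x [[Ax Bx] Sx]; rewrite -clA -clB; split.
      by rewrite -(clS A) //; apply: subset_closure.
    by rewrite -(clS B) //; apply: subset_closure.
have [_ _ _] := resN n; rewrite pn /= => /(_ _ split_n)[rkAe rkBe rkDe].
(* Taking the empty set for [D] shows that [e n] has rank 1 at stage [n.+1], where every later [e m]
   is still a loop. *)
have eS : S n.+1 (e n).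
  move=> m nm eq_e; have := rkDe set0 (@sub0set _ _).
  by rewrite set0U rk_set0 eq_e loop_e.
have SeS X : X `<=` S n -> X `|` [set e n] `<=` S n.+1.
  by move=> XS x [/XS | -> //]; apply: stageS.
have SS X : X `<=` S n -> X `<=` S n.+1.
  by move=> XS; apply: subset_trans XS (stageS _).
have Fe : F (e n) by rewrite -clA /closure /= !(@rk_stage n.+1); auto.
have Ge : G (e n) by rewrite -clB /closure /= !(@rk_stage n.+1); auto.
(* [D] spans the intersection of [F] and [G], which contains [e n], yet adding [e n] to [D] raises
   the rank. *)
have : rk L (D `|` [set e n]) <= rk L (F `&` G).
  by apply: rk_mono => x [/DFG | ->].
rewrite -rkD (@rk_stage n.+1); last exact: SeS.
rewrite rkDe; first by rewrite (LN D) // ltnn.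
move=> x Dx; have [Fx Gx] := DFG x Dx.
have DxS X : X `<=` S n -> X `|` [set x] `<=` S n.
  by move=> XS y [/XS | -> ]; last exact: DS.
split.
  by move: Fx; rewrite -clA /closure /= !LN; auto.
by move: Gx; rewrite -clB /closure /= !LN; auto.
Qed.

End Tower.

(* [m = 2 ^ j * (2 k + 1)] decodes to [j], so every value occurs beyond any
   bound. *)
Lemma infinitely_often_enumeration (T : countType) (t0 : T) :
  exists p : nat -> T, forall t n, exists2 m, n <= m & p m = t.
Proof.
exists (fun m => odflt t0 (unpickle (logn 2 m))) => t n.
exists (2 ^ pickle t * (n.*2).+1).
  have : 0 < 2 ^ pickle t by rewrite expn_gt0.
  nia.
rewrite lognM ?expn_gt0 // pfactorK // lognE dvdn2 /= odd_double /= addn0.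
by rewrite pickleK.
Qed.

(** * Construction of the tower on [nat] *)

(** Elements outside the range of [f] become loops, a supply of elements for the extensions. *)
Lemma preimage_matroid (E T : Type) (M : matroid E) (f : E -> T) :
  injective f -> exists N : matroid T, forall A, rk N A = rk M (f @^-1` A).
Proof.
move=> injf.
suff [N rkN] : exists N : matroid T, rk N = fun A => rk M (f @^-1` A).
  by exists N; rewrite rkN.
apply: matroid_of_rk => [|x|A B AB|A B|A].
- by rewrite preimage_set0 rk_set0.
- have [[y _ <-]|nx] := pselect (range f x).
    rewrite (_ : f @^-1` _ = [set y]) ?rk_set1 //.
    by apply/seteqP; split=> z /=; [move/injf | move->].
  rewrite (_ : f @^-1` _ = set0) ?rk_set0 //.
  by apply/seteqP; split=> z //= fz; apply: nx; exists z.
- by apply: rk_mono => x; apply: AB.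
- exact: rk_submod.
- have [B finB [BA rkB]] := rk_finitary M (f @^-1` A).
  exists (f @` B); first exact: finite_image.
  split; first by move=> _ [x /BA ? <-].
  rewrite -rkB; congr (rk M _); apply/seteqP; split=> x /=.
    by move=> [y By /injf <-].
  by move=> Bx; exists x.
Qed.

Unset Implicit Arguments.
Set Strict Implicit.

Theorem theorem12 (E : Type) (M : matroid E) (countE : countable [set: E]) :
  exists (S : Type) (N : matroid S) (f : E -> S),
    [/\ OTE N, rank N = rank M & embedding M N f].
Proof.
have [i injTi] := countable_injP _ countE.
pose f x := (i x).*2; pose e n := n.*2.+1.
have injf : injective f.
  by move=> x y /double_inj; apply: injTi; rewrite inE.
have [N0 rkN0] := preimage_matroid M injf.
(* Finite sets are coded by sequences, which form a countable type. *)
have [q qP] := infinitely_often_enumeration ([::] : seq nat, [::] : seq nat).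
pose p n : set nat * set nat := ([set` (q n).1], [set` (q n).2]).
have [step stepP] := choice (fun Mn : matroid nat * nat =>
  resolvesP Mn.1 (p Mn.2).1 (p Mn.2).2 (e Mn.2)).
pose N := fix N n := if n is m.+1 then step (N m, m) else N0.
have res n : rk (N n) [set e n] = 0 ->
    resolves (N n) (p n).1 (p n).2 (e n) (N n.+1) := stepP (N n, n).
(* Step [n] alters only the ranks of sets containing [e n], so [e m] stays a loop for [m] above [n];
   the induction hypothesis at [e n] itself is what makes [res] available. *)
have loop_e n m : n <= m -> rk (N n) [set e m] = 0.
  elim: n m => [|n IH] m nm.
    rewrite rkN0 (_ : f @^-1` _ = set0) ?rk_set0 //.
    by apply/seteqP; split=> x //=; rewrite /f /e; lia.
  have [_ rkE _ _] := res n (IH n (leqnn n)).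
  by rewrite rkE; [exact/IH/ltnW | rewrite /= /e; lia].
have resN n := res n (loop_e n n (leqnn n)).
have [L limL] : exists L : matroid nat,
    forall A, exists n, forall m, n <= m -> rk (N m) A = rk L A.
  apply: limit_matroid => n; first by have [] := resN n.
  by elim: n => // n <-; have [] := resN n.
have late_e (A : set nat) : finite_set A ->
    exists n, forall m, n <= m -> ~ A (e m).
  move: A; apply: finite_set_ind => [|x B [n Bn]]; first by exists 0 => ? _.
  exists (maxn n x) => m; rewrite geq_max => /andP[nm xm] [|/=]; first exact: Bn.
  by rewrite /e; lia.
have often_p (A B : set nat) n : finite_set A -> finite_set B ->
    exists2 m, n <= m & p m = (A, B).
  move=> /finite_seqP[s ->] /finite_seqP[t ->].
  by have [m nm qm] := qP (s, t) n; exists m => //; rewrite /p qm.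
exists nat, L, f; split; first exact: (tower_OTE loop_e resN limL late_e often_p).
  have [n /(_ _ (leqnn n)) rkL] := limL setT.
  rewrite /rank -rkL.
  elim: n {rkL} => [|n IH]; first by rewrite rkN0 preimage_setT.
  by have [_ _ + _] := resN n; rewrite /rank => ->.
split=> // A.
(* The range of [f] consists of even numbers, so it is present from stage 0 on. *)
rewrite (rk_stage resN limL (n := 0)).
  rewrite rkN0; congr (rk M _); apply/seteqP; split=> x /=.
    by move=> [y Ay /injf <-].
  by move=> Ax; exists x.
by move=> _ [x _ <-] m _; rewrite /f /e; lia.
Qed.
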